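(* For all $n\ge 1$ and $j\ge 1$, the number of permutations $\sigma\in S_n(231)$ with $\mathrm{des}(\sigma)=j$ and $\mathrm{maxdrop}(\sigma)=j$ equals $\binom{n+j-1}{2j}$. Consequently, the number of permutations $\sigma\in S_n(231)$ with $\mathrm{des}(\sigma)=j$ and $\mathrm{maxdrop}(\sigma)\le j-1$ equals $$\frac{1}{n}\binom{n}{j}\binom{n}{j+1}-\binom{n+j-1}{2j}.$$
   Context: For a permutation $\sigma=\sigma_1\cdots\sigma_n$ of $[n]$, $\mathrm{des}(\sigma)$ is the number of $i\in[n-1]$ with $\sigma_i>\sigma_{i+1}$, and $\mathrm{maxdrop}(\sigma)=\max\{i-\sigma_i : i\in[n]\}$. $S_n(231)$ is the set of permutations of $[n]$ with no indices $a<b<c$ such that $\sigma_c<\sigma_a<\sigma_b$. *)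

(* Defs.v *)
From mathcomp Require Import all_boot all_order all_algebra all_fingroup.

Set Implicit Arguments.
Unset Strict Implicit.
Unset Printing Implicit Defensive.

(* A permutation of [n] is an element of 'S_n, acting on {0, ..., n-1}: the    *)
(* positions and the values are both shifted by 1, which leaves des, the drops *)
(* i - s i and pattern avoidance unchanged.                                    *)

Definition des n (s : 'S_n) : nat :=
  #|[set i : 'I_n | [exists k : 'I_n, (k == i.+1 :> nat) && (s k < s i)]]|.

(* The subtraction is truncated. This does not change the maximum when n > 0:  *)
(* the differences i - s i sum to 0, so one of them is nonnegative.            *)
Definition maxdrop n (s : 'S_n) : nat := \max_(i < n) (i - s i).

Definition avoids231 n (s : 'S_n) : bool :=
  [forall a : 'I_n, forall b : 'I_n, forall c : 'I_n,
     ~~ [&& a < b, b < c, s c < s a & s a < s b]].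

(* Main.v *)
Require Import Defs.
From mathcomp Require Import all_boot all_order all_algebra all_fingroup.
From mathcomp Require Import zify ring.

(* A nonempty 231-avoiding word factors as L n R, where n is the maximum and   *)
(* every letter of L is smaller than every letter of R. When R is nonempty,    *)
(* des = des L + des R + 1 and maxdrop = max (maxdrop L) (maxdrop R + 1), so   *)
(* maxdrop <= des, with equality iff L is increasing and R is extremal; when   *)
(* R is empty both statistics are those of L. Summing over |L| turns this into *)
(* a hockey-stick recurrence for the extremal words. For the distribution of   *)
(* des alone, the generating function B of the nonempty words satisfies        *)
(* B = x(1 + B)(1 + tB), so the coefficients [x^(m+1) t^j] B^(k+1) obey a      *)
(* linear recurrence, which Pascal's rule shows is also that of                *)
(* C(m,j) C(m,k+j) - C(m,j-1) C(m,k+j+1).                                      *)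

Set Implicit Arguments.
Unset Strict Implicit.
Unset Printing Implicit Defensive.

Import GRing.Theory.

(** On 231-avoiding words maxdrop never exceeds des ([dropw_le_desw]), so the second count is the
    number with des = j minus the first count. The factorization at the maximum is a bijection
    ([perm_words]), and both counts come from it. An extremal word for j + 1 with R nonempty
    consists of the unique increasing L and an R extremal for j; this gives [count_extremalS], which
    two uses of Pascal's rule solve in [count_extremal]. For des alone, [coef_desgf_exp] finds the
    coefficients of all powers of B together; the first power gives the Narayana numbers
    ([narayana_rat]). [card_av231] carries the counts back to permutations. *)

(* Descents of x :: w; [desw 0 w] is des w, since no letter is below 0. *)
Fixpoint desw (x : nat) (w : seq nat) : nat :=
  if w is y :: w' then (y < x) + desw y w' else 0.

(* The letters of w occupy the positions o, o + 1, ... *)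
Fixpoint dropw (o : nat) (w : seq nat) : nat :=
  if w is y :: w' then maxn (o - y) (dropw o.+1 w') else 0.

(** The head [x] plays the 2 of the pattern; y stands before z in the tail. *)
Fixpoint av231 (w : seq nat) : bool :=
  if w is x :: w' then
    pairwise (fun y z => ~~ (z < x < y)) w' && av231 w'
  else true.

(** [R] is stored with its letters lowered by [size L], so that both factors are again words on an
    initial segment. *)
Definition joinw (L R : seq nat) : seq nat :=
  L ++ (size L + size R) :: map (addn (size L)) R.

Definition words (n : nat) : seq (seq nat) :=
  [seq w <- permutations (iota 0 n) | av231 w].

(** * Statistics under concatenation and shifting *)

Lemma desw_cat x p q : desw x (p ++ q) = desw x p + desw (last x p) q.
Proof. by elim: p x => //= y p IH x; rewrite IH addnA. Qed.

Lemma desw_map_addn k x w : desw (k + x) (map (addn k) w) = desw x w.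
Proof. by elim: w x => //= y w IH x; rewrite IH ltn_add2l. Qed.

Lemma desw_max m w : all (gtn m) w -> desw m w = (w != [::]) + desw 0 w.
Proof. by case: w => //= y w /andP [-> _]. Qed.

Lemma dropw_cat o p q : dropw o (p ++ q) = maxn (dropw o p) (dropw (o + size p) q).
Proof.
elim: p o => [|y p IH] o /=; first by rewrite max0n addn0.
by rewrite IH maxnA addSnnS.
Qed.

Lemma dropw_map_addn k o w : dropw (k + o) (map (addn k) w) = dropw o w.
Proof. by elim: w o => //= y w IH o; rewrite -addnS IH subnDl. Qed.

Lemma dropw_pred o w : (dropw o.+1 w).-1 = dropw o w.
Proof. by elim: w o => //= y w IH o; rewrite -(IH o.+1); lia. Qed.

(* With [dropw_pred]: a word with the letter 0 gains exactly 1 when shifted,   *)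
(* the truncated differences notwithstanding.                                  *)
Lemma dropw_gt0 o w : 0 \in w -> 0 < dropw o.+1 w.
Proof.
elim: w o => //= y w IH o; rewrite inE => /orP [/eqP <-|/IH h]; first lia.
by have := h o.+1; lia.
Qed.

Lemma mem_words n w : (w \in words n) = perm_eq w (iota 0 n) && av231 w.
Proof. by rewrite mem_filter mem_permutations andbC. Qed.

Lemma words_uniq n : uniq (words n).
Proof. by rewrite filter_uniq // permutations_uniq. Qed.

Lemma words0 : words 0 = [:: [::]].
Proof. by []. Qed.

Lemma size_words n w : w \in words n -> size w = n.
Proof. by rewrite mem_words => /andP [/perm_size ->]; rewrite size_iota. Qed.

Lemma mem_word n w x : w \in words n -> (x \in w) = (x < n).
Proof. by rewrite mem_words => /andP [/perm_mem -> _]; rewrite mem_iota. Qed.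

Lemma all_lt_word n w : w \in words n -> all (gtn n) w.
Proof. by move=> hw; apply/allP => x; rewrite (mem_word _ hw). Qed.

(** * Factorization at the maximum *)

Lemma desw_joinw n m L R : L \in words n -> R \in words m ->
  desw 0 (joinw L R) = desw 0 L + (desw 0 R + (0 < m)).
Proof.
move=> hL hR; rewrite /joinw desw_cat /= (size_words hL) (size_words hR).
have -> : (n + m < last 0 L) = false.
  apply/negbTE; rewrite -leqNgt; case: L hL => // x L hL /=.
  by apply/ltnW/ltn_addr; rewrite -(mem_word _ hL) mem_last.
rewrite desw_map_addn (desw_max (all_lt_word hR)) -(size_words hR).
by rewrite add0n [in LHS](addnC (nat_of_bool _)) -size_eq0 lt0n.
Qed.

(** The maximum itself has drop 0 after truncation. In R the positions move by n + 1 and the values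
    by n, so every drop grows by one. *)
Lemma dropw_joinw n m L R : L \in words n -> R \in words m ->
  dropw 0 (joinw L R) = maxn (dropw 0 L) (if 0 < m then (dropw 0 R).+1 else 0).
Proof.
move=> hL hR; rewrite /joinw dropw_cat /= (size_words hL) (size_words hR).
rewrite add0n -[n.+1]addn1 dropw_map_addn.
have -> : n - (n + m) = 0 by lia.
rewrite max0n; congr maxn.
case: ltnP => hm.
  by rewrite -(dropw_pred 0) prednK // dropw_gt0 // (mem_word _ hR).
have hm0 : size R = 0 by rewrite (size_words hR); lia.
by rewrite (size0nil hm0).
Qed.

Lemma av231_map_addn k w : av231 (map (addn k) w) = av231 w.
Proof.
elim: w => //= x w ->; rewrite pairwise_map; congr (_ && _).
by apply: eq_pairwise => y z /=; rewrite !ltn_add2l.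
Qed.

(** If x in L exceeds z in R, then x, m, z is a 231. Otherwise no occurrence can meet both sides,
    and m could only be its 3. *)
Lemma av231_cat_max m L R : all (gtn m) L -> all (gtn m) R ->
  av231 (L ++ m :: R) = [&& av231 L, av231 R & allrel leq L R].
Proof.
move=> hL hR; elim: L hL => [|x L IH] /= => [_|/andP [xm hL]].
  rewrite andbT andbC; case: (av231 R) => //=; apply/(pairwiseP 0) => i j hi hj ij.
  have /= := allP hR _ (mem_nth 0 hi).
  by rewrite negb_and -!leqNgt => /ltnW ->; rewrite orbT.
rewrite IH // pairwise_cat /= allrel_consl.
have [hx|/allPn [z hz hxz]] := boolP (all (leq x) R); last first.
  have -> : all (fun z : nat => ~~ (z < x < m)) R = false.
    apply/negbTE/allPn; exists z => //=.
    by move: hxz xm; rewrite /= -ltnNge => -> ->.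
  by rewrite !andbF.
have -> : allrel (fun y z => ~~ (z < x < y)) L (m :: R).
  apply/allrelP => y z _; rewrite inE => /orP [/eqP ->|]; first by move: xm => /=; lia.
  by move/(allP hx) => /=; lia.
have -> : all (fun z : nat => ~~ (z < x < m)) R.
  by apply/allP => z /(allP hx) /=; lia.
have -> : pairwise (fun y z => ~~ (z < x < y)) R.
  apply/(pairwiseP 0) => i j hi hj ij.
  by have /= := allP hx _ (mem_nth 0 hj); rewrite negb_and -!leqNgt => ->.
by rewrite /= !andbT -!andbA.
Qed.

(** Sorting L and R separately already sorts the whole, so the two sorted halves are the two
    segments of [iota]. *)
Lemma perm_iota_cat n L R : perm_eq (L ++ R) (iota 0 n) -> allrel leq L R ->
  perm_eq L (iota 0 (size L)) /\ perm_eq R (iota (size L) (size R)).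
Proof.
move=> hp hLR.
have hn : n = size L + size R.
  by have := perm_size hp; rewrite size_cat size_iota.
have E : sort leq L ++ sort leq R = iota 0 (size L) ++ iota (size L) (size R).
  rewrite -[X in iota X (size R)]add0n -iotaD -hn.
  apply: (sorted_eq leq_trans anti_leq); last 1 first.
  - by apply: perm_trans hp; rewrite perm_cat // perm_sort.
  - rewrite (sorted_pairwise leq_trans) pairwise_cat -!(sorted_pairwise leq_trans).
    rewrite !(sort_sorted leq_total) !andbT; apply/allrelP => x y.
    by rewrite !mem_sort => hx hy; apply: (allrelP hLR).
  - exact: iota_sorted.
move/eqP: E; rewrite eqseq_cat ?size_sort ?size_iota // => /andP [/eqP eL /eqP eR].
by rewrite -eL -eR !(perm_sym _ (sort _ _)) !perm_sort.
Qed.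

Lemma joinw_words n m L R : L \in words n -> R \in words m ->
  joinw L R \in words (n + m).+1.
Proof.
move=> hL hR; have sL := size_words hL; have sR := size_words hR.
rewrite mem_words /joinw sL sR av231_cat_max.
- rewrite av231_map_addn.
  move: (hL) (hR); rewrite !mem_words => /andP [pL ->] /andP [pR ->].
  apply/andP; split.
    rewrite -[(n + m).+1]addn1 iotaD add0n perm_catC /= -cat1s.
    rewrite perm_sym perm_catC /= perm_cons perm_sym iotaD add0n.
    rewrite perm_catC perm_cat // -[X in iota X m](addn0 n) iotaDl.
    exact: perm_map.
  apply/allrelP => x y; rewrite (mem_word _ hL) => /ltnW hx /mapP [z _ ->].
  exact: leq_trans hx (leq_addr _ _).
- by apply/allP => x; rewrite (mem_word _ hL) /=; lia.
- by apply/allP => x /mapP [z]; rewrite (mem_word _ hR) /= => ? ->; lia.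
Qed.

Lemma words_joinw n w : w \in words n.+1 -> exists L R,
  [/\ size L <= n, L \in words (size L), R \in words (n - size L) & w = joinw L R].
Proof.
move=> hw; have hn : n \in w by rewrite (mem_word _ hw).
case/splitPr: hn hw => L R hw.
have pw : perm_eq (L ++ R) (iota 0 n).
  move: hw; rewrite mem_words => /andP [].
  rewrite -[n.+1]addn1 iotaD add0n -(cat1s n R) perm_catCA.
  by rewrite perm_sym (perm_catC (iota 0 n)) perm_sym /= perm_cons => ->.
have hlt x : x \in L ++ R -> x < n by rewrite (perm_mem pw) mem_iota.
have hs : size L + size R = n by rewrite -size_cat (perm_size pw) size_iota.
have hL : all (gtn n) L by apply/allP => x hx; apply: hlt; rewrite mem_cat hx.
have hR : all (gtn n) R by apply/allP => x hx; apply: hlt; rewrite mem_cat hx orbT.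
have := hw; rewrite mem_words av231_cat_max // => /and4P [_ aL aR aLR].
have [pL pR] := perm_iota_cat pw aLR.
(* The letters of R are at least [size L], so the truncated subtraction can be undone. *)
have eR : R = map (addn (size L)) (map (subn^~ (size L)) R).
  rewrite -map_comp -[LHS]map_id; apply/eq_in_map => x /=.
  by rewrite (perm_mem pR) mem_iota => /andP [h _]; rewrite subnKC.
exists L, (map (subn^~ (size L)) R); split.
- lia.
- by rewrite mem_words pL.
- rewrite mem_words -(av231_map_addn (size L)) -eR aR andbT.
  have -> : n - size L = size R by lia.
  apply: (@perm_map_inj _ _ (addn (size L))); first exact: addnI.
  by rewrite -eR -iotaDl addn0.
- by rewrite /joinw size_map hs -eR.
Qed.

(** The position of the maximum recovers [size L], hence the cut. *)
Lemma joinw_inj L R L' R' :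
  all (gtn (size L + size R)) L -> all (gtn (size L' + size R')) L' ->
  joinw L R = joinw L' R' -> L = L' /\ R = R'.
Proof.
have idx A m B : all (gtn m) A -> index m (A ++ m :: B) = size A.
  move=> hA; rewrite index_cat /= eqxx addn0; case: ifP => // h.
  by have := allP hA _ h; rewrite /= ltnn.
move=> h h' E.
have s : size L + size R = size L' + size R'.
  have := congr1 size E; rewrite /joinw !size_cat /= !size_map; lia.
have sL : size L = size L'.
  have := congr1 (index (size L + size R)) E.
  by rewrite /joinw idx // s idx.
move/eqP: E; rewrite /joinw eqseq_cat // => /andP [/eqP eL].
rewrite eqseq_cons sL => /andP [_ /eqP]; move/(inj_map (@addnI _)) => eR.
by [].
Qed.

Lemma perm_words n : perm_eq (words n.+1)
  [seq joinw L R | L <- flatten [seq words k | k <- iota 0 n.+1],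
                   R <- words (n - size L)].
Proof.
have memL L : (L \in flatten [seq words k | k <- iota 0 n.+1]) =
    (size L <= n) && (L \in words (size L)).
  apply/flatten_mapP/andP => [[k]|[h1 h2]].
    by rewrite mem_iota add0n => /andP [_ hk] hL; rewrite (size_words hL).
  by exists (size L); rewrite ?mem_iota.
apply: uniq_perm; first exact: words_uniq.
- apply: allpairs_uniq_dep.
  + elim: (n.+1) {memL} => // k IH; rewrite -addn1 iotaD map_cat flatten_cat.
    rewrite cat_uniq IH /= cats0 words_uniq andbT.
    apply/hasPn => w hw; apply/negP => /flatten_mapP [i].
    by rewrite mem_iota -(size_words hw) => + hi; rewrite (size_words hi); lia.
  + by move=> *; exact: words_uniq.
  + move=> [L R] [L' R'] /allpairsPdep [x [y [+ + [-> ->]]]]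
      /allpairsPdep [x' [y' [+ + [-> ->]]]] /=.
    rewrite !memL => /andP [h1 h2] h3 /andP [h4 h5] h6 E.
    have [] := joinw_inj _ _ E; last by move=> -> ->.
      by rewrite (size_words h3) subnKC //; apply/allP => z;
      rewrite (mem_word _ h2) => hz; apply: leq_trans hz h1.
    by rewrite (size_words h6) subnKC //; apply/allP => z;
    rewrite (mem_word _ h5) => hz; apply: leq_trans hz h4.
- move=> w; apply/idP/allpairsPdep
    => [/words_joinw [L [R [h1 h2 h3 ->]]]|[L [R []]]].
    by exists L, R; rewrite memL h1 h2.
  rewrite memL => /andP [h1 h2] h3 ->.
  by have := joinw_words h2 h3; rewrite subnKC.
Qed.

(** Stated for any [nmodType], to serve both polynomial weights and counts in [nat]. *)
Lemma sum_words (V : nmodType) (F : seq nat -> V) n :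
  (\sum_(w <- words n.+1) F w = \sum_(k < n.+1) \sum_(L <- words k)
     \sum_(R <- words (n - k)) F (joinw L R))%R.
Proof.
rewrite (perm_big _ (perm_words n)) big_allpairs_dep big_flatten big_map.
rewrite -[iota 0 n.+1]/(index_iota 0 n.+1) big_mkord; apply: eq_bigr => k _.
by apply: eq_big_seq => L hL; rewrite (size_words hL).
Qed.

(** By induction, max(a, b + 1) is at most a' + b' + 1 when a <= a' and b <= b'. *)
Lemma dropw_le_desw n w : w \in words n -> dropw 0 w <= desw 0 w.
Proof.
elim/ltn_ind: n w => -[|n] IH w; first by rewrite words0 inE => /eqP ->.
move=> /words_joinw [L [R [h1 h2 h3 ->]]].
rewrite (desw_joinw h2 h3) (dropw_joinw h2 h3).
have := IH _ _ _ h2; have := IH _ _ _ h3.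
rewrite !ltnS leq_subr h1 => /(_ isT) hR /(_ isT) hL; case: ltnP => _; lia.
Qed.

(** * Distribution of des *)

Section DescentPolynomial.
Local Open Scope ring_scope.

Definition desp (n : nat) : {poly int} := \sum_(w <- words n) 'X^(desw 0 w).

(* Equal to (k+1)/(m+1) C(m+1,j) C(m+1,k+j+1), written as a determinant of    *)
(* binomials so that its recurrences follow from Pascal's rule alone.          *)
Definition narayana_coef (k m j : nat) : int :=
  ('C(m, j) * 'C(m, k + j))%:Z
  - (if j is i.+1 then 'C(m, i) * 'C(m, (k + j).+1) else 0%N)%:Z.

Lemma desp0 : desp 0 = 1.
Proof. by rewrite /desp words0 big_seq1. Qed.

Lemma despS n :
  desp n.+1 = \sum_(k < n.+1) desp k * (if (k < n)%N then 'X * desp (n - k) else 1).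
Proof.
rewrite /desp sum_words; apply: eq_bigr => k _; rewrite mulr_suml.
apply: eq_big_seq => L hL; case: ifPn => hk.
  rewrite !mulr_sumr; apply: eq_big_seq => R hR.
  by rewrite (desw_joinw hL hR) subn_gt0 hk addn1 exprD exprS.
have -> : (n - k = 0)%N by move: (ltn_ord k); lia.
by rewrite words0 big_seq1 (@desw_joinw k 0) //= !addn0 mulr1.
Qed.

(* The series B of the header, truncated after degree M. *)
Definition desgf (M : nat) : {poly {poly int}} :=
  \poly_(n < M.+1) (if n is 0%N then 0 else desp n).

(** The equation B = x(1 + B)(1 + tB) in degree n + 1, where the truncation is not felt; x is the
    outer variable and t the inner one. *)
Lemma desgf_fix M n : (n < M)%N ->
  (desgf M)`_n.+1 = ((1 + desgf M) * (1 + 'X%:P * desgf M))`_n.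
Proof.
move=> hn; rewrite coefM coef_poly ltnS hn despS; apply: eq_bigr => k _.
rewrite !coefD coefCM !coef1 !coef_poly.
have hk := ltn_ord k.
have -> : (k < M.+1)%N by lia.
have -> : (n - k < M.+1)%N by lia.
congr (_ * _).
  by case: (k : nat) => [|i]; rewrite ?desp0 ?addr0 ?add0r.
rewrite -subn_gt0; case: (n - k)%N => [|i]; rewrite ?mulr0 ?addr0 //.
by rewrite add0r.
Qed.

Lemma coef_mul_eq (R : nzRingType) (p q r : {poly R}) n :
  (forall i, (i <= n)%N -> p`_i = q`_i) -> (p * r)`_n = (q * r)`_n.
Proof. by move=> h; rewrite !coefM; apply: eq_bigr => i _; rewrite h // -ltnS. Qed.

(** Multiplying the equation of B by B^k gives B^(k+1) = x(B^k + (1 + t)B^(k+1) + tB^(k+2)). *)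
Lemma desgf_exp M k n : (n < M)%N ->
  (desgf M ^+ k.+1)`_n.+1 = (desgf M ^+ k)`_n
    + (1 + 'X) * (desgf M ^+ k.+1)`_n + 'X * (desgf M ^+ k.+2)`_n.
Proof.
move=> hn; rewrite [in LHS]exprS.
(* One factor B is replaced by x(1 + B)(1 + tB), which agrees with it only up to degree M. *)
rewrite (@coef_mul_eq _ _ ('X * ((1 + desgf M) * (1 + 'X%:P * desgf M)))).
  rewrite -mulrA coefXM /=.
  have -> : (1 + desgf M) * (1 + 'X%:P * desgf M) * desgf M ^+ k =
    desgf M ^+ k + (1 + 'X)%:P * desgf M ^+ k.+1 + 'X%:P * desgf M ^+ k.+2.
    by rewrite !exprS polyCD; ring.
  by rewrite !coefD !coefCM.
move=> [|i] hi; rewrite coefXM /= ?desgf_fix //; last by lia.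
by rewrite coef_poly.
Qed.

Lemma narayana_coefS k m j : narayana_coef k.+1 m.+1 j =
  narayana_coef k m j + narayana_coef k.+1 m j
  + (if j is i.+1 then narayana_coef k.+1 m i + narayana_coef k.+2 m i else 0).
Proof.
rewrite /narayana_coef; case: j => [|[|i]].
- by rewrite !addn0 !bin0 binS; lia.
- rewrite !addn1 !addn0 !binS !bin0; lia.
- rewrite !addSn !addnS !binS; lia.
Qed.

(** The recurrence for the first power of B: the term B^0 vanishes in positive degree. *)
Lemma narayana_coef0S m j : narayana_coef 0 m.+1 j =
  narayana_coef 0 m j
  + (if j is i.+1 then narayana_coef 0 m i + narayana_coef 1 m i else 0).
Proof.
rewrite /narayana_coef; case: j => [|[|i]].
- by rewrite !addn0 !bin0.
- rewrite !add0n !addn0 !binS !bin0; lia.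
- rewrite !add0n !add1n !binS; lia.
Qed.

Lemma coef_desgf_exp M k m j : (m < M)%N ->
  ((desgf M ^+ k.+1)`_m.+1)`_j = narayana_coef k m j.
Proof.
elim: m k j => [|m IH] k j hm; rewrite desgf_exp //.
  (* B has no constant term, so only B^0 survives in degree 0. *)
  have E i : (desgf M ^+ i)`_0 = (i == 0%N)%:R.
    by rewrite -horner_coef0 horner_exp horner_coef0 coef_poly expr0n.
  rewrite !E !mulr0 !addr0 /narayana_coef.
  by case: k => [|k]; case: j => [|[|j]]; rewrite ?coef1 ?coef0 ?addn0 ?addn1 ?bin0n.
rewrite !coefD mulrDl mul1r coefD !coefXM !IH; [|lia..].
case: k => [|k].
  rewrite expr0 coef1 coef0 add0r narayana_coef0S -addrA; congr (_ + _).
  by case: j => [|j] //=; rewrite !IH //; lia.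
rewrite IH; last by lia.
rewrite narayana_coefS -!addrA; congr (_ + (_ + _)).
by case: j => [|j] //=; rewrite !IH //; lia.
Qed.

Lemma desp_coef m j : (desp m.+1)`_j = narayana_coef 0 m j.
Proof. by rewrite -(@coef_desgf_exp m.+1 0 m j) // expr1 coef_poly ltnS leqnn. Qed.

Lemma bin_stepR (m i : nat) :
  i.+1%:R * 'C(m, i.+1)%:R = (m%:R - i%:R) * 'C(m, i)%:R :> rat.
Proof.
have [h|h] := leqP i m; first by rewrite -natrB // -!natrM mul_bin_left.
by rewrite !bin_small ?mulr0 // ltnW.
Qed.

Lemma narayana_rat m j :
  (narayana_coef 0 m j.+1)%:~R
  = m.+1%:R^-1 * 'C(m.+1, j.+1)%:R * 'C(m.+1, j.+2)%:R :> rat.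
Proof.
rewrite /narayana_coef rmorphB /= -!pmulrn !natrM !add0n !binS !natrD.
have h1 := bin_stepR m j; have h2 := bin_stepR m j.+1.
have hm : m.+1%:R != 0 :> rat by rewrite Num.Theory.pnatr_eq0.
apply: (mulfI hm); rewrite !mulrA mulfV // mul1r.
move: h1 h2; rewrite -[m.+1%:R]natr1 -[j.+2%:R]natr1 -[j.+1%:R]natr1.
move: 'C(m, j)%:R 'C(m, j.+1)%:R 'C(m, j.+2)%:R m%:R j%:R => u v w x y h1 h2.
apply/eqP; rewrite -subr_eq0; apply/eqP.
(* With u, v, w the consecutive binomials, x = m and y = j, the difference is a combination of the
   relations [h1] and [h2]. *)
transitivity ((v + w) * ((y + 1) * v - (x - y) * u)
              - (u + v) * ((y + 1 + 1) * w - (x - (y + 1)) * v)); first by ring.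
by rewrite h1 h2 !subrr !mulr0 subrr.
Qed.
End DescentPolynomial.

(** * Extremal words *)

Lemma count_des_words n j :
  Posz (count (fun w => desw 0 w == j) (words n)) = ((desp n)`_j)%R.
Proof.
rewrite /desp coef_sum -sum1_count big_mkcond /= (big_morph Posz PoszD (erefl _)).
by apply: eq_bigr => w _; rewrite coefXn eq_sym; case: eqP.
Qed.

Lemma count_des0 n : count (fun w => desw 0 w == 0) (words n) = 1.
Proof.
apply/eqP; rewrite -eqz_nat count_des_words; case: n => [|n].
  by rewrite desp0 coef1.
by rewrite desp_coef /narayana_coef !bin0.
Qed.

Definition extremal j w := (desw 0 w == j) && (dropw 0 w == j).

Lemma count_extremal0 n : count (extremal 0) (words n) = 1.
Proof.
rewrite -(count_des0 n); apply: eq_in_count => w hw; rewrite /extremal.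
by case: eqP => //= h; have := dropw_le_desw hw; rewrite h leqn0.
Qed.

Lemma count_words P n : count P (words n.+1) =
  \sum_(k < n.+1) \sum_(L <- words k) count (fun R => P (joinw L R)) (words (n - k)).
Proof.
rewrite -sum1_count big_mkcond.
transitivity (\sum_(k < n.+1) \sum_(L <- words k) \sum_(R <- words (n - k))
  if P (joinw L R) then 1 else 0); first exact: sum_words.
by apply: eq_bigr => k _; apply: eq_bigr => L _; rewrite -sum1_count [RHS]big_mkcond.
Qed.

(** The last term is the case of empty R. When R is nonempty, a descent in L would make both entries
    of the maximum smaller than des; so des L = 0, which leaves one L of each length. *)
Lemma count_extremalS n j : count (extremal j.+1) (words n.+1) =
  \sum_(k < n) count (extremal j) (words (n - k)) + count (extremal j.+1) (words n).
Proof.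
rewrite count_words big_ord_recr /= subnn words0.
congr (_ + _); last first.
  rewrite -[RHS]sum1_count [RHS]big_mkcond; apply: eq_big_seq => L hL /=.
  rewrite /extremal (@desw_joinw _ 0 _ _ hL) // (@dropw_joinw _ 0 _ _ hL) //.
  by rewrite !addn0 maxn0; case: ifP.
apply: eq_bigr => k _.
transitivity (\sum_(L <- words k | desw 0 L == 0) count (extremal j) (words (n - k))).
  rewrite [RHS]big_mkcond; apply: eq_big_seq => L hL.
  have h : 0 < n - k by rewrite subn_gt0.
  have hL' := dropw_le_desw hL.
  case: ifP => hd.
    apply: eq_in_count => R hR.
    rewrite /extremal (desw_joinw hL hR) (dropw_joinw hL hR) h.
    move/eqP: hd hL' => ->.
    by rewrite leqn0 => /eqP ->; rewrite add0n addn1 max0n !eqSS.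
  apply/eqP; rewrite -leqn0 leqNgt -has_count; apply/hasPn => R hR.
  rewrite /extremal (desw_joinw hL hR) (dropw_joinw hL hR) h.
  have hR' := dropw_le_desw hR.
  by apply/negP => /andP [/eqP h1 /eqP h2]; move: hd; lia.
by rewrite big_const_seq count_des0 /= addn0.
Qed.

Lemma count_extremal n j :
  count (extremal j) (words n.+1) = 'C(n + j, 2 * j).
Proof.
elim: j n => [|j IHj] n; first by rewrite count_extremal0 muln0 bin0.
(* Hockey stick: the summands are C(m - k - 1 + j, 2j). *)
have S m : \sum_(k < m) count (extremal j) (words (m - k)) = 'C(m + j, (2 * j).+1).
  elim: m => [|m IH]; first by rewrite big_ord0 bin_small // add0n; lia.
  by rewrite big_ord_recl subn0 IHj addSn binS -IH [RHS]addnC; congr (_ + _).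
elim: n => [|n IH].
  by rewrite count_extremalS big_ord0 words0 bin_small //; lia.
by rewrite count_extremalS S IH mulnS !addSn !addnS [RHS]binS [RHS]addnC.
Qed.

(** * Permutations as words *)

Definition word n (s : 'S_n) : seq nat := [seq val (s i) | i <- enum 'I_n].

Lemma size_word n (s : 'S_n) : size (word s) = n.
Proof. by rewrite size_map size_enum_ord. Qed.

Lemma nth_word n (s : 'S_n) (i : 'I_n) : nth 0 (word s) i = s i.
Proof. by rewrite (nth_map i) ?size_enum_ord // nth_ord_enum. Qed.

Lemma word_inj n : injective (@word n).
Proof. by move=> s t E; apply/permP => i; apply: val_inj; rewrite /= -!nth_word E. Qed.

Lemma perm_word n (s : 'S_n) : perm_eq (word s) (iota 0 n).
Proof.
have u : uniq (word s).
  by rewrite map_inj_uniq ?enum_uniq // => i j /val_inj /perm_inj.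
apply: uniq_perm => //; first exact: iota_uniq.
apply: (uniq_min_size u _ _).2; last by rewrite size_word size_iota.
by move=> x /mapP [i _ ->]; rewrite mem_iota /=.
Qed.

(** [word] is injective into the permutations of [iota 0 n], and both sides have n! elements. *)
Lemma perm_map_word n :
  perm_eq (map (@word n) (enum {: 'S_n})) (permutations (iota 0 n)).
Proof.
have u : uniq (map (@word n) (enum {: 'S_n})).
  by rewrite map_inj_uniq ?enum_uniq //; exact: word_inj.
apply: uniq_perm => //; first exact: permutations_uniq.
apply: (uniq_min_size u _ _).2.
  by move=> w /mapP [s _ ->]; rewrite mem_permutations perm_word.
by rewrite size_permutations ?iota_uniq // size_map -cardE card_Sn size_iota.
Qed.

Lemma av231P w : reflect
  (forall a b c, a < b -> b < c -> c < size w ->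
     ~~ ((nth 0 w c < nth 0 w a) && (nth 0 w a < nth 0 w b)))
  (av231 w).
Proof.
elim: w => [|x w IH] /=; first by constructor.
apply: (iffP andP) => [[/(pairwiseP 0) hp /IH hw] [|a] [|b] [|c] //= ab bc cw|h].
- by apply: hp; rewrite ?inE; lia.
- exact: hw.
split.
  by apply/(pairwiseP 0) => b c hb hc bc; apply: (h 0 b.+1 c.+1).
by apply/IH => a b c ab bc cw; apply: (h a.+1 b.+1 c.+1).
Qed.

Lemma avoids231_word n (s : 'S_n) : avoids231 s = av231 (word s).
Proof.
apply/idP/av231P => [/forallP h a b c ab bc|h].
  rewrite size_word => cn.
  have bn := ltn_trans bc cn; have an := ltn_trans ab bn.
  have /forallP /(_ (Ordinal bn)) /forallP /(_ (Ordinal cn)) := h (Ordinal an).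
  by rewrite -!nth_word /= ab bc.
apply/forallP => a; apply/forallP => b; apply/forallP => c.
apply/negP => /and4P [ab bc h1 h2].
by have := h a b c ab bc; rewrite size_word !nth_word h1 h2 => /(_ (ltn_ord c)).
Qed.

Lemma dropwE o w : dropw o w = \max_(i < size w) (o + i - nth 0 w i).
Proof.
elim: w o => [|y w IH] o /=; first by rewrite big_ord0.
rewrite big_ord_recl /= addn0 IH; congr maxn.
by apply: eq_bigr => i _; rewrite addSnnS.
Qed.

Lemma maxdrop_word n (s : 'S_n) : maxdrop s = dropw 0 (word s).
Proof.
by rewrite dropwE size_word; apply: eq_bigr => i _; rewrite nth_word.
Qed.

Lemma deswE x w : desw x w = \sum_(i < size w) (nth 0 w i < nth 0 (x :: w) i).
Proof.
elim: w x => [|y w IH] x /=; first by rewrite big_ord0.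
by rewrite big_ord_recl IH.
Qed.

Lemma des_word n (s : 'S_n) : des s = desw 0 (word s).
Proof.
rewrite /des -sum1dep_card big_mkcond deswE size_word.
case: n s => [|n] s; first by rewrite !big_ord0.
(* [des] indexes a descent by its top, [desw] by its bottom. The last position has no successor and
   the first letter is compared with 0, so both extra terms vanish. *)
rewrite big_ord_recr [RHS]big_ord_recl /= addnC; congr (_ + _).
  by case: existsP => // -[k /andP [/eqP hk _]]; have := ltn_ord k; rewrite hk ltnn.
apply: eq_bigr => i _; rewrite (nth_word s (lift ord0 i)).
rewrite -[nth _ _ i]/(nth 0 (word s) (widen_ord (leqnSn n) i)) nth_word.
have E : [exists k : 'I_n.+1, (k == i.+1 :> nat) && (s k < s (widen_ord (leqnSn n) i))]
   = (s (lift ord0 i) < s (widen_ord (leqnSn n) i)).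
  apply/existsP/idP => [[k /andP [/eqP hk]]|h].
    by have -> : k = lift ord0 i by apply: val_inj.
  by exists (lift ord0 i); rewrite eqxx.
by rewrite E; case: ifP.
Qed.

Lemma card_av231 n (P : pred (seq nat)) :
  #|[set s : 'S_n | avoids231 s && P (word s)]| = count P (words n).
Proof.
rewrite count_filter -(seq.permP (perm_map_word n)) count_map cardsE cardE.
rewrite [in LHS]/enum_mem size_filter -enumT; apply: eq_count => s.
by rewrite [RHS]andbC [X in _ && X]/= -avoids231_word.
Qed.

Theorem theorem13 (n j : nat) (hn : 1 <= n) (hj : 1 <= j) :
  #|[set s : 'S_n | [&& avoids231 s, des s == j & maxdrop s == j]]|
    = 'C(n + j - 1, 2 * j)
  /\
  (#|[set s : 'S_n | [&& avoids231 s, des s == j & maxdrop s <= j - 1]%N]|%:R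
    = n%:R^-1 * 'C(n, j)%:R * 'C(n, (j + 1)%N)%:R
      - 'C((n + j - 1)%N, (2 * j)%N)%:R :> rat)%R.
Proof.
have eqj : #|[set s : 'S_n | [&& avoids231 s, des s == j & maxdrop s == j]]|
    = 'C(n + j - 1, 2 * j).
  transitivity (count (extremal j) (words n)).
    rewrite -card_av231; apply: eq_card => s.
    by rewrite !inE /extremal des_word maxdrop_word.
  by rewrite -(prednK hn) count_extremal addSn subn1.
split=> //; rewrite -eqj.
set A := [set s | _]; set B := [set s | _].
(* [A] has maxdrop <= j - 1 and [B] has maxdrop = j; they are disjoint since j >= 1, and maxdrop <=
   des leaves no other case. *)
have cAB : #|A| + #|B| = count (fun w => desw 0 w == j) (words n).
  rewrite -card_av231 -cardsUI.
  have -> : A :&: B = set0.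
    apply/setP => s; rewrite !inE.
    by apply/negP => /andP [/and3P [_ _ h] /and3P [_ _ /eqP h']]; lia.
  rewrite cards0 addn0; apply: eq_card => s; rewrite !inE -des_word maxdrop_word.
  case: (boolP (avoids231 s)) => //= hs; case: eqP => //= h.
  have := @dropw_le_desw n (word s).
  rewrite mem_words perm_word -avoids231_word hs -des_word.
  by move=> /(_ isT); lia.
apply/eqP; rewrite eq_sym subr_eq -natrD cAB; apply/eqP.
have := count_des_words n j; case: n hn A B cAB {eqj} => // m _ _ _ _.
case: j hj => // i _; rewrite desp_coef addn1 -narayana_rat => <-.
by rewrite pmulrn.
Qed.
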